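(* Let $\alpha,\beta,\gamma\in(1,2)$ and let $c,d,e\ge0$ be variable coefficients depending on $(x,y,z,t)$. For the three-dimensional Riesz fractional diffusion equation $$\frac{\partial u}{\partial t}=c\,\frac{\partial^\alpha u}{\partial|x|^\alpha}+d\,\frac{\partial^\beta u}{\partial|y|^\beta}+e\,\frac{\partial^\gamma u}{\partial|z|^\gamma}+f$$ on $(x_L,x_R)\times(y_L,y_R)\times(z_L,z_R)\times(0,T]$ with homogeneous Dirichlet boundary conditions, consider, with the matrices $A_x=A_{3D,\Delta x}^{k+1/2}$, $A_y=A_{3D,\Delta y}^{k+1/2}$, $A_z=A_{3D,\Delta z}^{k+1/2}$ specified in the context, the D-AD scheme $$(I-A_x)U^{k,1}=(I+A_x+2A_y+2A_z)U^{k}+\Delta t\,F^{k+1/2},$$ $$(I-A_y)U^{k,2}=U^{k,1}-A_yU^{k},\qquad (I-A_z)U^{k+1}=U^{k,2}-A_zU^{k},$$ defined by the factored system $$(I-A_x)(I-A_y)(I-A_z)U^{k+1}=(I+A_x)(I+A_y)(I+A_z)U^{k}+\Delta t\,F^{k+1/2}.$$ If the matrices $A_{3D,\Delta x}^{k+1/2}$, $A_{3D,\Delta y}^{k+1/2}$ and $A_{3D,\Delta z}^{k+1/2}$ commute, then this D-AD scheme is unconditionally stable.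
   Context: Grid: $\Delta x=(x_R-x_L)/N_x$, $\Delta y=(y_R-y_L)/N_y$, $\Delta z=(z_R-z_L)/N_z$, $\Delta t=T/N_t$, $x_i=x_L+i\Delta x$, $y_j=y_L+j\Delta y$, $z_l=z_L+l\Delta z$, $t_k=k\Delta t$, $t_{k+1/2}=(t_k+t_{k+1})/2$; $c_{i,j,l}^{k+1/2}=c(x_i,y_j,z_l,t_{k+1/2})$, similarly for $d,e$. The vectors $U^k$ (approximations of $u$ at time $t_k$), $U^{k,1}$, $U^{k,2}$ (intermediate solutions) are indexed by interior points $1\le i\le N_x-1$, $1\le j\le N_y-1$, $1\le l\le N_z-1$; $F^{k+1/2}$ contains the values of $f$ at time $t_{k+1/2}$ (and absorbs the Dirichlet boundary data). The three-step form and the factored form are regarded as one and the same scheme, the factored form being the one taken to result from eliminating $U^{k,1}$ and $U^{k,2}$. The Riesz derivative of order $\nu\in(1,2)$ is $\frac{\partial^\nu u}{\partial|x|^\nu}=-\kappa_\nu\left({}_{x_L}D_x^\nu+{}_xD_{x_R}^\nu\right)u$, where $\kappa_\nu=\frac{1}{2\cos(\nu\pi/2)}$ and the two operators are the left and right Riemann–Liouville derivatives; analogously in $y$ and $z$. For $\nu\in(1,2)$ define $g_0^\nu=1$, $g_1^\nu=-4+2^{3-\nu}$, $g_2^\nu=6-2^{5-\nu}+3^{3-\nu}$, and for $m\ge 3$ $$g_m^\nu=(m+1)^{3-\nu}-4m^{3-\nu}+6(m-1)^{3-\nu}-4(m-2)^{3-\nu}+(m-3)^{3-\nu}.$$ Let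 $\widetilde g_{i,i}^\nu=2g_1^\nu$; $\widetilde g_{i,m}^\nu=g_0^\nu+g_2^\nu$ if $|i-m|=1$; and $\widetilde g_{i,m}^\nu=g_{|i-m|+1}^\nu$ if $|i-m|\ge 2$. $A_x,A_y,A_z$ are the square matrices of size $(N_x-1)(N_y-1)(N_z-1)$ acting on interior grid vectors $U=(u_{i,j,l})$ by $$(A_xU)_{i,j,l}=\frac{-\Delta t\,\kappa_\alpha c_{i,j,l}^{k+1/2}}{2\Gamma(4-\alpha)\Delta x^\alpha}\sum_{m=1}^{N_x-1}\widetilde g_{i,m}^\alpha u_{m,j,l},$$ $$(A_yU)_{i,j,l}=\frac{-\Delta t\,\kappa_\beta d_{i,j,l}^{k+1/2}}{2\Gamma(4-\beta)\Delta y^\beta}\sum_{m=1}^{N_y-1}\widetilde g_{j,m}^\beta u_{i,m,l},$$ $$(A_zU)_{i,j,l}=\frac{-\Delta t\,\kappa_\gamma e_{i,j,l}^{k+1/2}}{2\Gamma(4-\gamma)\Delta z^\gamma}\sum_{m=1}^{N_z-1}\widetilde g_{l,m}^\gamma u_{i,j,m}.$$ Sense of stability: ''unconditionally'' means with no restriction on the step sizes; stability is understood through the criterion that the spectral radii of $(I-A_x)^{-1}(I+A_x)$, $(I-A_y)^{-1}(I+A_y)$ and $(I-A_z)^{-1}(I+A_z)$ are all less than $1$.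
   Formalization: With c,d,e≥0 only, radii <1 fails (c=0 gives radius 1), so <1 is proved in each direction whose coefficient is positive at all interior nodes at time t_{k+1/2}; for c,d,e≥0 radii ≤1 and bounded powers of the factored scheme's amplification matrix are proved. *)

(* Defs.v *)
From HB Require Import structures.
From mathcomp Require Import all_boot all_order all_algebra.
From mathcomp Require Import complex.
From mathcomp Require Import all_classical all_reals all_analysis.
Set Implicit Arguments.
Unset Strict Implicit.
Unset Printing Implicit Defensive.
Import Order.TTheory GRing.Theory Num.Theory.
Import numFieldNormedType.Exports.
Local Open Scope classical_set_scope.
Local Open Scope ring_scope.

Section Coefficients.
Variable R : realType.
Implicit Types s nu : R.

(* Euler's integral; meaningful for 0 < s, used at s = 4 - nu in ]2, 3[. *)
Definition Gamma s : R :=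
  Rintegral (@lebesgue_measure R) `[0, +oo[ (fun t => t `^ (s - 1) * expR (- t)).

Definition kappa nu : R := (2 * cos (nu * pi / 2))^-1.

Definition g nu (m : nat) : R :=
  match m with
  | 0 => 1
  | 1 => - 4 + 2 `^ (3 - nu)
  | 2 => 6 - 2 `^ (5 - nu) + 3 `^ (3 - nu)
  | _ => (m + 1)%:R `^ (3 - nu) - 4 * m%:R `^ (3 - nu)
         + 6 * (m - 1)%:R `^ (3 - nu) - 4 * (m - 2)%:R `^ (3 - nu)
         + (m - 3)%:R `^ (3 - nu)
  end.

Definition gtilde nu (i m : nat) : R :=
  let dist := ((i - m) + (m - i))%N in (* |i - m|, subtraction on nat being truncated *)
  if dist == 0 then 2 * g nu 1
  else if dist == 1 then g nu 0 + g nu 2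
  else g nu (dist + 1).

End Coefficients.

Section Mesh.
Variable R : realType.

Definition step (a b : R) (N : nat) : R := (b - a) / N%:R.
Definition node (a h : R) (i : nat) : R := a + i%:R * h.
Definition tmid (dt : R) (k : nat) : R := (k%:R * dt + k.+1%:R * dt) / 2.

End Mesh.

(* Interior nodes. The triple (i, j, l) of ordinals, which start at 0, stands for
   the node of indices (i+1, j+1, l+1). *)
Definition interior (Nx Ny Nz : nat) : finType :=
  ('I_Nx.-1 * 'I_Ny.-1 * 'I_Nz.-1)%type.

Section GridMatrices.
Variables (R : realType) (Nx Ny Nz : nat).
Local Notation G := (interior Nx Ny Nz).

(* Values at the interior nodes, at time t, of a function of (x, y, z, t). *)
Definition sample (xL hx yL hy zL hz t : R) (c : R -> R -> R -> R -> R) (p : G) : R :=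
  c (node xL hx p.1.1.+1) (node yL hy p.1.2.+1) (node zL hz p.2.+1) t.

Definition gvec (w : G -> R) : 'cV[R]_#|G| := \col_p w (enum_val p).
Definition gmat (K : G -> G -> R) : 'M[R]_#|G| :=
  \matrix_(p, q) K (enum_val p) (enum_val q).

(* c : values of the diffusion coefficient at the interior nodes. *)
Definition Ax (nu h dt : R) (c : G -> R) : 'M[R]_#|G| :=
  gmat (fun p q =>
    if (p.1.2 == q.1.2) && (p.2 == q.2)
    then - dt * kappa nu * c p / (2 * Gamma (4 - nu) * h `^ nu)
         * gtilde nu p.1.1.+1 q.1.1.+1
    else 0).

Definition Ay (nu h dt : R) (c : G -> R) : 'M[R]_#|G| :=
  gmat (fun p q =>
    if (p.1.1 == q.1.1) && (p.2 == q.2)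
    then - dt * kappa nu * c p / (2 * Gamma (4 - nu) * h `^ nu)
         * gtilde nu p.1.2.+1 q.1.2.+1
    else 0).

Definition Az (nu h dt : R) (c : G -> R) : 'M[R]_#|G| :=
  gmat (fun p q =>
    if (p.1.1 == q.1.1) && (p.1.2 == q.1.2)
    then - dt * kappa nu * c p / (2 * Gamma (4 - nu) * h `^ nu)
         * gtilde nu p.2.+1 q.2.+1
    else 0).

Lemma gmatE (K : G -> G -> R) w p :
  (gmat K *m gvec w) (enum_rank p) 0 = \sum_q K p q * w q.
Proof.
rewrite mxE (reindex (@enum_val G G)) /=; last first.
  by exists enum_rank => q _; rewrite ?enum_valK ?enum_rankK.
by apply: eq_bigr => q _; rewrite !mxE enum_rankK.
Qed.

Lemma AxE nu h dt c w i j l :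
  (Ax nu h dt c *m gvec w) (enum_rank (i, j, l)) 0 =
  - dt * kappa nu * c (i, j, l) / (2 * Gamma (4 - nu) * h `^ nu)
  * \sum_(m < Nx.-1) gtilde nu i.+1 m.+1 * w (m, j, l).
Proof.
rewrite gmatE mulr_sumr (bigID (fun q : G => (j == q.1.2) && (l == q.2))) /=.
rewrite [X in _ + X]big1 ?addr0; last by move=> q /negPf->; rewrite mul0r.
rewrite (reindex (fun m : 'I_Nx.-1 => (m, j, l) : G)) /=; last first.
  exists (fun q : G => q.1.1) => [//|[[a b] f]] /=.
  by rewrite inE /= => /andP[/eqP<- /eqP<-].
apply: eq_big => [m|m _]; rewrite !eqxx //=; rewrite [RHS]mulrA //.
Qed.

Lemma AyE nu h dt c w i j l :
  (Ay nu h dt c *m gvec w) (enum_rank (i, j, l)) 0 =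
  - dt * kappa nu * c (i, j, l) / (2 * Gamma (4 - nu) * h `^ nu)
  * \sum_(m < Ny.-1) gtilde nu j.+1 m.+1 * w (i, m, l).
Proof.
rewrite gmatE mulr_sumr (bigID (fun q : G => (i == q.1.1) && (l == q.2))) /=.
rewrite [X in _ + X]big1 ?addr0; last by move=> q /negPf->; rewrite mul0r.
rewrite (reindex (fun m : 'I_Ny.-1 => (i, m, l) : G)) /=; last first.
  exists (fun q : G => q.1.2) => [//|[[a b] f]] /=.
  by rewrite inE /= => /andP[/eqP<- /eqP<-].
apply: eq_big => [m|m _]; rewrite !eqxx //=; rewrite [RHS]mulrA //.
Qed.

Lemma AzE nu h dt c w i j l :
  (Az nu h dt c *m gvec w) (enum_rank (i, j, l)) 0 =
  - dt * kappa nu * c (i, j, l) / (2 * Gamma (4 - nu) * h `^ nu)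
  * \sum_(m < Nz.-1) gtilde nu l.+1 m.+1 * w (i, j, m).
Proof.
rewrite gmatE mulr_sumr (bigID (fun q : G => (i == q.1.1) && (j == q.1.2))) /=.
rewrite [X in _ + X]big1 ?addr0; last by move=> q /negPf->; rewrite mul0r.
rewrite (reindex (fun m : 'I_Nz.-1 => (i, j, m) : G)) /=; last first.
  exists (fun q : G => q.2) => [//|[[a b] f]] /=.
  by rewrite inE /= => /andP[/eqP<- /eqP<-].
apply: eq_big => [m|m _]; rewrite !eqxx //=; rewrite [RHS]mulrA //.
Qed.

End GridMatrices.

Section Scheme.
Variables (R : realType) (n : nat).
Implicit Types (A M : 'M[R]_n) (U V F : 'cV[R]_n).

(* The modulus is taken over the complex eigenvalues of the real matrix M; they
   are finitely many, and for n = 0 the value is sup set0 = 0. *)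
Definition spectral_radius M : R :=
  sup [set r | exists2 z : R[i],
         eigenvalue (map_mx (real_complex R) M) z & r = Normc.normc z].

Definition cayley A : 'M[R]_n := invmx (1%:M - A) *m (1%:M + A).

(* One time step U -> V of the factored scheme. Eliminating the intermediate
   vectors from the three-step form gives the same left-hand side but - A B C
   instead of + A B C in the matrix applied to U; the factored system is the one
   that defines the scheme. *)
Definition dad_step (A B C : 'M[R]_n) (dt : R) F U V : Prop :=
  (1%:M - A) *m (1%:M - B) *m (1%:M - C) *m V =
  (1%:M + A) *m (1%:M + B) *m (1%:M + C) *m U + dt *: F.

Definition pairwise_commute (A B C : 'M[R]_n) : Prop :=
  [/\ A *m B = B *m A, A *m C = C *m A & B *m C = C *m B].

(* The step is uniquely solvable, and a perturbation of U is multiplied by the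
   product of the three one-dimensional amplification matrices. *)
Definition dad_amplification (A B C : 'M[R]_n) (dt : R) F : Prop :=
  [/\ [/\ 1%:M - A \in unitmx, 1%:M - B \in unitmx & 1%:M - C \in unitmx],
      forall U, exists! V, dad_step A B C dt F U V &
      forall U U' V V', dad_step A B C dt F U V -> dad_step A B C dt F U' V' ->
        V' - V = cayley A *m cayley B *m cayley C *m (U' - U)].

Definition power_bounded M : Prop :=
  exists K : R, forall (m : nat) (i j : 'I_n), `|(M ^+ m) i j| <= K.

End Scheme.

(* Main.v *)
(* Each of A_x, A_y, A_z is A = - D S with D >= 0 diagonal (the sampled coefficient)
   and S symmetric. Up to a positive factor, the entries of S along a grid line are minus
   the fourth central differences of |x|^(3-nu). Off the diagonal these differences
   are nonnegative, and their partial sums telescope to third differences of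
   x^(3-nu), which are negative; hence S is strictly diagonally dominant with
   positive diagonal, so it is coercive.

   A is symmetric negative semidefinite for the inner product of S, so its Cayley
   transform contracts the energy u^T S u and has bounded powers. The commuting
   product of three such transforms therefore also has bounded powers, although the
   three energies differ. For a left eigenvector v of the Cayley transform with
   eigenvalue z, put p = v D v^* and q = (v D) S (v D)^*; then z (p + q) = p - q,
   where p, q >= 0, and p, q > 0 if D > 0. *)
Require Import Defs.
From HB Require Import structures.
From mathcomp Require Import all_boot all_order all_algebra.
From mathcomp Require Import complex.
From mathcomp Require Import all_classical all_reals all_analysis.
From mathcomp Require Import measurable_realfun ring lra zify.
Import Order.TTheory GRing.Theory Num.Theory.
Import numFieldNormedType.Exports.
Local Open Scope ring_scope.

Set Implicit Arguments.
Unset Strict Implicit.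
Unset Printing Implicit Defensive.

(** * Cayley transforms and quadratic forms *)
Section LinearAlgebra.
Variables (R : realType) (n : nat).
Implicit Types (M S A B C : 'M[R]_n) (u v a b : 'cV[R]_n) (d : 'rV[R]_n).

Definition bform M u v : R := (u^T *m M *m v) 0 0.

Definition coercive S : Prop :=
  exists2 del : R, 0 < del & forall u, del * (\sum_i u i 0 ^+ 2) <= bform S u u.

Lemma bformDr M u v1 v2 : bform M u (v1 + v2) = bform M u v1 + bform M u v2.
Proof. by rewrite /bform mulmxDr mxE. Qed.

Lemma bformZr M u v x : bform M u (x *: v) = x * bform M u v.
Proof. by rewrite /bform -scalemxAr mxE. Qed.

Lemma bformNr M u v : bform M u (- v) = - bform M u v.
Proof. by rewrite -scaleN1r bformZr mulN1r. Qed.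

Lemma bform_tr M u v : bform M^T u v = bform M v u.
Proof.
rewrite /bform -[in RHS](trmxK (v^T *m M *m u)) [in RHS]mxE.
by rewrite !trmx_mul trmxK mulmxA.
Qed.

Lemma bformC M u v : M^T = M -> bform M u v = bform M v u.
Proof. by move=> MT; rewrite -bform_tr MT. Qed.

Lemma bformMl N M u v : bform M (N *m u) v = bform (N^T *m M) u v.
Proof. by rewrite /bform trmx_mul !mulmxA. Qed.

Lemma bformMr N M u v : bform M u (N *m v) = bform (M *m N) u v.
Proof. by rewrite /bform !mulmxA. Qed.

Lemma bform_sqrD M u v : M^T = M ->
  bform M (u + v) (u + v) = bform M u u + 2 * bform M u v + bform M v v.
Proof.
move=> MT; rewrite bformDr !(@bformC M (u + v))// !bformDr (@bformC M v u)//.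
by rewrite mulr_natl mulr2n !addrA.
Qed.

Lemma bform_diag d u : bform (diag_mx d) u u = \sum_i d 0 i * u i 0 ^+ 2.
Proof.
rewrite /bform mul_mx_diag mxE; apply: eq_bigr => i _.
by rewrite !mxE expr2 mulrA (mulrC (u i 0) (d 0 i)).
Qed.

Lemma sum_sqr_eq0 u : \sum_i u i 0 ^+ 2 <= 0 -> u = 0.
Proof.
move=> u0; have u00 : \sum_i u i 0 ^+ 2 = 0.
  by apply/eqP; rewrite eq_le u0 sumr_ge0// => i _; exact: sqr_ge0.
apply/colP => i; rewrite mxE; apply/eqP; rewrite -sqrf_eq0.
by apply/eqP; move: i (erefl true); apply/(psumr_eq0P _ u00) => i _; exact: sqr_ge0.
Qed.

Lemma coercive_ge0 S u : coercive S -> 0 <= bform S u u.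
Proof.
move=> [del del0 h]; apply: le_trans (h u); rewrite mulr_ge0 ?(ltW del0)//.
by apply: sumr_ge0 => i _; exact: sqr_ge0.
Qed.

Lemma coercive_eq0 S u : coercive S -> bform S u u <= 0 -> u = 0.
Proof.
move=> [del del0 /(_ u) h] u0; apply: sum_sqr_eq0.
by rewrite -(pmulr_rle0 _ del0); exact: le_trans u0.
Qed.

(* Comparing the coercivity bound on the iterates with the energy of the initial
   data on the basis vectors bounds the entries. *)
Lemma contraction_power_bounded S C : coercive S ->
  (forall u, bform S (C *m u) (C *m u) <= bform S u u) -> power_bounded C.
Proof.
move=> cS ctr; have [del del0 hS] := cS.
pose e j : 'cV[R]_n := delta_mx j 0.
exists (1 + \sum_j bform S (e j) (e j) / del) => m i j.
have iter_le : bform S (C ^+ m *m e j) (C ^+ m *m e j) <= bform S (e j) (e j).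
  elim: m => [|m IH]; first by rewrite expr0 mul1mx.
  by apply: le_trans IH; rewrite exprS -mulmxA; exact: ctr.
have Cij : (C ^+ m *m e j) i 0 = (C ^+ m) i j.
  by rewrite -colE mxE.
have sqr_le : (C ^+ m) i j ^+ 2 <= bform S (e j) (e j) / del.
  rewrite ler_pdivlMr// mulrC; apply: le_trans iter_le; apply: le_trans (hS _).
  rewrite ler_pM2l// -Cij (bigD1 i)//= lerDl.
  by apply: sumr_ge0 => l _; exact: sqr_ge0.
(* The energy controls squares of entries; |x| <= 1 + x^2 passes to absolute values, and the sum
   over columns makes the bound uniform in j. *)
apply: (@le_trans _ _ (1 + (C ^+ m) i j ^+ 2)).
  rewrite -real_normK ?num_real//; set x := `| _ |.
  by have := sqr_ge0 (x - 1); have : 0 <= x := normr_ge0 _; nra.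
rewrite lerD2l; apply: le_trans sqr_le _.
rewrite (bigD1 j)//= lerDl; apply: sumr_ge0 => l _.
by rewrite divr_ge0 ?(ltW del0)//; exact: coercive_ge0.
Qed.

(** Commutation gives (AB)^m = A^m B^m, so only entrywise bounds are multiplied. This is how factors
    contracting different energies are combined. *)
Lemma power_boundedM A B : A *m B = B *m A ->
  power_bounded A -> power_bounded B -> power_bounded (A *m B).
Proof.
move=> cAB [KA hA] [KB hB]; exists (\sum_(l < n) KA * KB) => m i j.
have -> : (A *m B) ^+ m = A ^+ m *m B ^+ m by exact: exprMn_comm.
rewrite mxE; apply: le_trans (ler_norm_sum _ _ _) _; apply: ler_sum => l _.
by rewrite normrM; apply: ler_pM.
Qed.

Lemma comm_invmx A B : A *m B = B *m A -> A *m invmx B = invmx B *m A.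
Proof.
move=> cAB; case: (boolP (B \in unitmx)) => [uB|nB]; last first.
  (* [invmx] returns a singular matrix unchanged, so the goal reduces to the hypothesis. *)
  by rewrite /invmx (negPf nB).
by rewrite -{1}(mulKmx uB A) -cAB -!mulmxA mulmxV// mulmx1.
Qed.

Lemma comm_1D A B : A *m B = B *m A -> A *m (1%:M + B) = (1%:M + B) *m A.
Proof. by move=> h; rewrite mulmxDr mulmxDl mulmx1 mul1mx h. Qed.

Lemma comm_1B A B : A *m B = B *m A -> A *m (1%:M - B) = (1%:M - B) *m A.
Proof. by move=> h; rewrite mulmxBr mulmxBl mulmx1 mul1mx h. Qed.

Lemma comm_cayley A B : A *m B = B *m A -> A *m cayley B = cayley B *m A.
Proof.
move=> h; rewrite /cayley mulmxA comm_invmx; last exact: comm_1B.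
by rewrite -!mulmxA comm_1D.
Qed.

Lemma cayley_comm A B : A *m B = B *m A ->
  cayley A *m cayley B = cayley B *m cayley A.
Proof. by move=> h; apply/comm_cayley/esym/comm_cayley. Qed.

(** The source cancels in a difference of two steps. Each 1 + M is (1 - M) times its Cayley
    transform, and commuting the factors brings out the invertible matrix [L] on the left, where it
    cancels. *)
Lemma dad_amplificationP A B C (dt : R) F : pairwise_commute A B C ->
  1%:M - A \in unitmx -> 1%:M - B \in unitmx -> 1%:M - C \in unitmx ->
  dad_amplification A B C dt F.
Proof.
move=> [cAB cAC cBC] uA uB uC.
pose L := (1%:M - A) *m (1%:M - B) *m (1%:M - C).
have uL : L \in unitmx by rewrite !unitmx_mul uA uB uC.
split => //.
  move=> U; exists (invmx L *m
    ((1%:M + A) *m (1%:M + B) *m (1%:M + C) *m U + dt *: F)).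
  split; first by rewrite /dad_step -/L mulKVmx.
  by move=> V; rewrite /dad_step -/L => <-; rewrite mulKmx.
move=> U U' V V' hV hV'.
have : (1%:M - A) *m (1%:M - B) *m (1%:M - C) *m (V' - V) =
       (1%:M + A) *m (1%:M + B) *m (1%:M + C) *m (U' - U).
  by rewrite mulmxBr hV' hV [RHS]mulmxBr opprD addrACA subrr addr0.
have -> : (1%:M + A) *m (1%:M + B) *m (1%:M + C) =
   (1%:M - A) *m (1%:M - B) *m (1%:M - C) *m (cayley A *m cayley B *m cayley C).
  have cay M : 1%:M - M \in unitmx -> 1%:M + M = (1%:M - M) *m cayley M.
    by move=> uM; rewrite /cayley mulKVmx.
  rewrite {1}(cay A)// {1}(cay B)// {1}(cay C)//.
  have hAB : (1%:M - B) *m cayley A = cayley A *m (1%:M - B).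
    by apply/comm_cayley/esym/comm_1B.
  have hAC : (1%:M - C) *m cayley A = cayley A *m (1%:M - C).
    by apply/comm_cayley/esym/comm_1B.
  have hBC : (1%:M - C) *m cayley B = cayley B *m (1%:M - C).
    by apply/comm_cayley/esym/comm_1B.
  move: (cayley A) (cayley B) (cayley C) hAB hAC hBC => X Y Z hX hXC hY.
  rewrite -!mulmxA; congr (_ *m _).
  rewrite (mulmxA X) -hX -!mulmxA; congr (_ *m _).
  by rewrite (mulmxA Y) -hY -mulmxA (mulmxA X) -hXC -!mulmxA.
by rewrite -(mulmxA _ _ (U' - U)) => /(can_inj (mulKmx uL)).
Qed.

(** * Spectral radius and eigenvectors of a Cayley transform *)

Section Spectrum.
Local Notation rc := (real_complex R).
Local Notation cRe := (@complex.Re R).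
Local Notation cIm := (@complex.Im R).

Lemma normc_sqr (z : R[i]) : Normc.normc z ^+ 2 = cRe z ^+ 2 + cIm z ^+ 2.
Proof. by case: z => x y /=; rewrite sqr_sqrtr// addr_ge0 ?sqr_ge0. Qed.

Lemma normc_ge0 (z : R[i]) : 0 <= Normc.normc z.
Proof. by case: z => x y /=; exact: sqrtr_ge0. Qed.

Lemma spectral_radius_le1 M :
  (forall z, eigenvalue (map_mx rc M) z -> cRe z ^+ 2 + cIm z ^+ 2 <= 1) ->
  spectral_radius M <= 1.
Proof.
move=> hM; rewrite /spectral_radius; set E := (X in sup X).
have [->|/set0P E0] := eqVneq E set0; first by rewrite sup0.
apply: ge_sup => // r [z hz ->].
by rewrite -(@ler_pXn2r _ 2)// ?nnegrE ?normc_ge0// normc_sqr expr1n hM.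
Qed.

(** A supremum keeps a strict bound only because the eigenvalues are finitely many: they lie among
    the roots of the characteristic polynomial. *)
Lemma spectral_radius_lt1 M :
  (forall z, eigenvalue (map_mx rc M) z -> cRe z ^+ 2 + cIm z ^+ 2 < 1) ->
  spectral_radius M < 1.
Proof.
move=> hM; rewrite /spectral_radius; set E := (X in sup X).
have [->|/set0P E0] := eqVneq E set0; first by rewrite sup0.
have [rs rsE] := closed_field_poly_normal (char_poly (map_mx rc M)).
pose P (z : R[i]) := Normc.normc z < 1.
(* Filtering the roots by [P] makes [m] < 1 immediate; every eigenvalue passes the filter. *)
pose m : R := \big[Num.max/0]_(z <- rs | P z) Normc.normc z.
apply: (@le_lt_trans _ _ m); rewrite /m.
  apply: ge_sup => // r [z hz ->]; apply: le_bigmax_seq; last first.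
    by rewrite /P -(@ltr_pXn2r _ 2)// ?nnegrE ?normc_ge0// normc_sqr expr1n hM.
  move: hz; rewrite eigenvalue_root_char rsE rootZ ?root_prod_XsubC//.
  by rewrite lead_coef_eq0 monic_neq0// char_poly_monic.
by apply: bigmax_lt => // z.
Qed.

Lemma Re_mulmx (v : 'rV[R[i]]_n) M :
  map_mx cRe (v *m map_mx rc M) = map_mx cRe v *m M.
Proof.
apply/rowP => j; rewrite !mxE raddf_sum; apply: eq_bigr => l _; rewrite !mxE.
by case: (v 0 l) => p q /=; rewrite mulr0 subr0.
Qed.

Lemma Im_mulmx (v : 'rV[R[i]]_n) M :
  map_mx cIm (v *m map_mx rc M) = map_mx cIm v *m M.
Proof.
apply/rowP => j; rewrite !mxE raddf_sum; apply: eq_bigr => l _; rewrite !mxE.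
by case: (v 0 l) => p q /=; rewrite mulr0 add0r.
Qed.

Lemma Re_scalemx (z : R[i]) (v : 'rV[R[i]]_n) :
  map_mx cRe (z *: v) = cRe z *: map_mx cRe v - cIm z *: map_mx cIm v.
Proof. by apply/rowP => j; rewrite !mxE; case: z (v 0 j) => x y [p q]. Qed.

Lemma Im_scalemx (z : R[i]) (v : 'rV[R[i]]_n) :
  map_mx cIm (z *: v) = cRe z *: map_mx cIm v + cIm z *: map_mx cRe v.
Proof. by apply/rowP => j; rewrite !mxE; case: z (v 0 j) => x y [p q]. Qed.

(* [a] and [b] are the real and imaginary parts of a left eigenvector. *)
Lemma cayley_eigenvector A z : 1%:M - A \in unitmx ->
    eigenvalue (map_mx rc (cayley A)) z ->
  exists a b, [/\ (a != 0) || (b != 0),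
    a + A^T *m a = cRe z *: (a - A^T *m a) - cIm z *: (b - A^T *m b) &
    b + A^T *m b = cRe z *: (b - A^T *m b) + cIm z *: (a - A^T *m a)].
Proof.
move=> uA /eigenvalueP[v vE v0].
pose a := map_mx cRe v; pose b := map_mx cIm v.
(* Multiplying the eigenvalue equation on the right by 1 - A clears the inverse. *)
have {}vE : v *m map_mx rc (1%:M + A) = z *: (v *m map_mx rc (1%:M - A)).
  have -> : 1%:M + A = cayley A *m (1%:M - A).
    rewrite /cayley -comm_invmx; last by apply: comm_1B; apply/esym/comm_1D.
    by rewrite mulmxKV.
  by rewrite map_mxM mulmxA vE scalemxAl.
have trD k l (M N : 'M[R]_(k, l)) : (M + N)^T = M^T + N^T by rewrite linearD.
have trB k l (M N : 'M[R]_(k, l)) : (M - N)^T = M^T - N^T by rewrite linearB.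
have trZ (x : R) (w : 'rV[R]_n) : (x *: w)^T = x *: w^T by rewrite linearZ.
have trE := (trB, trD, trZ, trmx_mul, trmx1, mulmxBl, mulmxDl, mul1mx).
exists a^T, b^T; split.
- apply: contraNT v0; rewrite negb_or !negbK !trmx_eq0 => /andP[/eqP a0 /eqP b0].
  apply/eqP/rowP => j; rewrite mxE.
  have := congr1 (fun u : 'rV[R]_n => u 0 j) a0.
  have := congr1 (fun u : 'rV[R]_n => u 0 j) b0.
  by rewrite !mxE; case: (v 0 j) => p q /= -> ->.
- have /= := congr1 (fun w => (map_mx cRe w)^T) vE.
  by rewrite Re_scalemx !Re_mulmx Im_mulmx -/a -/b !trE.
- have /= := congr1 (fun w => (map_mx cIm w)^T) vE.
  by rewrite Im_scalemx !Im_mulmx Re_mulmx -/a -/b !trE.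
Qed.
End Spectrum.

(** * Generators - D S with D nonnegative diagonal and S symmetric coercive *)

Section DiagonalTimesCoercive.
Variables (d : 'rV[R]_n) (S : 'M[R]_n).
Hypotheses (d_ge0 : forall i, 0 <= d 0 i) (S_sym : S^T = S) (S_coer : coercive S).
Local Notation D := (diag_mx d).
Let A := - (D *m S).

Lemma bform_diag_ge0 u : 0 <= bform D u u.
Proof. by rewrite bform_diag sumr_ge0// => i _; rewrite mulr_ge0 ?sqr_ge0. Qed.

Lemma bform_diag_eq0 u : (forall i, 0 < d 0 i) -> bform D u u <= 0 -> u = 0.
Proof.
move=> d_gt0 u0; have u00 : bform D u u = 0.
  by apply/eqP; rewrite eq_le u0 bform_diag_ge0.
apply/colP => i; rewrite mxE; apply/eqP; rewrite -sqrf_eq0.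
rewrite -(mulrI_eq0 _ (mulfI (lt0r_neq0 (d_gt0 i)))); apply/eqP.
move: i (erefl true); apply/psumr_eq0P; last by rewrite -bform_diag.
by move=> i _; rewrite mulr_ge0 ?sqr_ge0.
Qed.

Lemma bform_DSD u v : bform D u (S *m (D *m v)) = bform S (D *m u) (D *m v).
Proof. by rewrite bformMl tr_diag_mx bformMr. Qed.

Lemma trmx_generator : A^T = - (S *m D).
Proof. by rewrite /A linearN /= trmx_mul S_sym tr_diag_mx. Qed.

(** A transposed left kernel vector satisfies u = - S D u. Pairing with D gives 0 <= u^T D u = - (D
    u)^T S (D u), so D u = 0 by coercivity, and then u = 0. *)
Lemma sub_unitmx : 1%:M - A \in unitmx.
Proof.
rewrite -row_free_unit -kermx_eq0; apply/rowV0P => v /sub_kermxP /(congr1 trmx).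
rewrite trmx_mul trmx0 linearB /= trmx1 trmx_generator opprK => h.
apply: trmx_inj; rewrite trmx0; move: v^T h => {v} u.
rewrite mulmxDl mul1mx -mulmxA => /eqP; rewrite addr_eq0 => /eqP uE.
have Du0 : D *m u = 0.
  apply: (coercive_eq0 S_coer); rewrite -bform_DSD -oppr_ge0 -bformNr -uE.
  exact: bform_diag_ge0.
by rewrite uE Du0 mulmx0 oppr0.
Qed.

(** With w = (1 - A)^-1 u, the vectors compared are w + A w and w - A w; their S-energies differ by
    four times the S-product of w and A w, which is - (S w)^T D (S w) <= 0. *)
Lemma cayley_contraction u :
  bform S (cayley A *m u) (cayley A *m u) <= bform S u u.
Proof.
have uA := sub_unitmx.
pose w := invmx (1%:M - A) *m u.
have -> : cayley A *m u = w + A *m w.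
  rewrite /cayley -comm_invmx.
    by rewrite -mulmxA -/w mulmxDl mul1mx.
  by apply: comm_1B; apply/esym/comm_1D.
have -> : u = w - A *m w by rewrite -{1}(mulKVmx uA u) -/w mulmxBl mul1mx.
have Aw : A *m w = - (D *m (S *m w)) by rewrite mulNmx mulmxA.
rewrite !bform_sqrD// !bformNr -subr_ge0.
have -> : bform S w (A *m w) = - bform D (S *m w) (S *m w).
  by rewrite Aw bformNr bformMl S_sym bformMr.
rewrite (@bformC _ (- _))// bformNr.
by have := bform_diag_ge0 (S *m w); lra.
Qed.

Lemma cayley_power_bounded : power_bounded (cayley A).
Proof. exact: contraction_power_bounded S_coer cayley_contraction. Qed.

(** Both equations are paired with a and b in the D-form. The symmetry of D and S cancels the cross
    terms. *)
Lemma eigen_balance a b (x y : R) :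
    a + A^T *m a = x *: (a - A^T *m a) - y *: (b - A^T *m b) ->
    b + A^T *m b = x *: (b - A^T *m b) + y *: (a - A^T *m a) ->
  let p := bform D a a + bform D b b in
  let q := bform S (D *m a) (D *m a) + bform S (D *m b) (D *m b) in
  y * (p + q) = 0 /\ x * (p + q) = p - q.
Proof.
rewrite trmx_generator !mulNmx !opprK -!mulmxA => ha hb p q.
have pC : bform D b a = bform D a b by rewrite bformC// tr_diag_mx.
have qC : bform S (D *m b) (D *m a) = bform S (D *m a) (D *m b) by rewrite bformC.
have := congr1 (bform D a) ha; have := congr1 (bform D b) ha.
have := congr1 (bform D a) hb; have := congr1 (bform D b) hb.
rewrite !(bformDr, bformNr, bformZr) !bform_DSD pC qC /p /q.
by split; lra.
Qed.

(** If p + q > 0, the balance forces y = 0 and |x| = |p - q| / (p + q) <= 1. Since D may be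
    singular, q = 0 is treated apart: A^T then kills a and b, and the eigenvalue is 1. *)
Lemma eigen_norm_le1 a b (x y : R) : (a != 0) || (b != 0) ->
    a + A^T *m a = x *: (a - A^T *m a) - y *: (b - A^T *m b) ->
    b + A^T *m b = x *: (b - A^T *m b) + y *: (a - A^T *m a) ->
  x ^+ 2 + y ^+ 2 <= 1.
Proof.
move=> ab0 ha hb; have [] := eigen_balance ha hb.
have := bform_diag_ge0 a; have := bform_diag_ge0 b.
have := coercive_ge0 (D *m a) S_coer; have := coercive_ge0 (D *m b) S_coer.
set qb := bform S _ _; set qa := bform S _ _; set pb := bform D _ _.
set pa := bform D _ _ => qb0 qa0 pb0 pa0 hy hx.
have [q0|q0] := leP (qa + qb) 0.
  have Da : D *m a = 0 by apply: (coercive_eq0 S_coer); rewrite -/qa; lra.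
  have Db : D *m b = 0 by apply: (coercive_eq0 S_coer); rewrite -/qb; lra.
  move: ha hb; rewrite trmx_generator !mulNmx -!mulmxA Da Db.
  rewrite !mulmx0 oppr0 !addr0 !subr0 => ha hb.
  suff : (x - 1) ^+ 2 + y ^+ 2 = 0.
    have := sqr_ge0 (x - 1); have := sqr_ge0 y; move=> y2 x2 r0.
    have /eqP : (x - 1) ^+ 2 = 0 by lra.
    by rewrite sqrf_eq0 => /eqP; nra.
  apply/eqP; apply: contraLR ab0 => r0; rewrite negb_or !negbK.
  (* Each pair of entries solves a homogeneous 2 x 2 system with determinant (x - 1)^2 + y^2. *)
  have entry0 i : a i 0 = 0 /\ b i 0 = 0.
    have /(congr1 (fun u : 'cV[R]_n => u i 0)) := hb.
    have /(congr1 (fun u : 'cV[R]_n => u i 0)) := ha.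
    rewrite !mxE; move: (a i 0) (b i 0) => s t hs ht.
    have {}hs : x * s - y * t - s = 0 by lra.
    have {}ht : x * t + y * s - t = 0 by lra.
    split; apply: (mulfI r0); rewrite mulr0.
      transitivity ((x - 1) * (x * s - y * t - s) + y * (x * t + y * s - t)).
        by ring.
      by rewrite hs ht !mulr0 addr0.
    transitivity ((x - 1) * (x * t + y * s - t) - y * (x * s - y * t - s)).
      by ring.
    by rewrite hs ht !mulr0 subr0.
  by apply/andP; split; apply/eqP/colP => i; rewrite mxE; case: (entry0 i).
have y0 : y = 0 by apply/eqP; move/eqP: hy; rewrite mulf_eq0 => /orP[//|/eqP]; lra.
have r_gt0 : 0 < pa + pb + (qa + qb) by lra.
rewrite y0 expr0n addr0 -(ler_pM2r (exprn_gt0 2 r_gt0)) -exprMn hx.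
by nra.
Qed.

(** A positive diagonal makes D injective, so p and q are both positive and |p - q| < p + q. *)
Lemma eigen_norm_lt1 a b (x y : R) : (forall i, 0 < d 0 i) ->
    (a != 0) || (b != 0) ->
    a + A^T *m a = x *: (a - A^T *m a) - y *: (b - A^T *m b) ->
    b + A^T *m b = x *: (b - A^T *m b) + y *: (a - A^T *m a) ->
  x ^+ 2 + y ^+ 2 < 1.
Proof.
move=> d_gt0 ab0 ha hb; have [] := eigen_balance ha hb.
have := bform_diag_ge0 a; have := bform_diag_ge0 b.
have := coercive_ge0 (D *m a) S_coer; have := coercive_ge0 (D *m b) S_coer.
set qb := bform S _ _; set qa := bform S _ _; set pb := bform D _ _.
set pa := bform D _ _ => qb0 qa0 pb0 pa0 hy hx.
have D_inj u : D *m u = 0 -> u = 0.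
  move=> Du; apply: bform_diag_eq0 => //.
  by rewrite /bform -mulmxA Du mulmx0 mxE.
have p_gt0 : 0 < pa + pb.
  rewrite ltNge; apply: contraL ab0 => p0; rewrite negb_or !negbK.
  by apply/andP; split; apply/eqP/bform_diag_eq0 => //; rewrite -/pa -/pb; lra.
have q_gt0 : 0 < qa + qb.
  rewrite ltNge; apply: contraL ab0 => q0; rewrite negb_or !negbK.
  apply/andP; split; apply/eqP/D_inj/(coercive_eq0 S_coer);
    by rewrite -/qa -/qb; lra.
have y0 : y = 0 by apply/eqP; move/eqP: hy; rewrite mulf_eq0 => /orP[//|/eqP]; lra.
rewrite y0 expr0n addr0 -(ltr_pM2r (exprn_gt0 2 (addr_gt0 p_gt0 q_gt0))).
by rewrite -exprMn hx; nra.
Qed.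

Lemma spectral_radius_cayley_le1 : spectral_radius (cayley A) <= 1.
Proof.
apply: spectral_radius_le1 => z /(cayley_eigenvector sub_unitmx).
by move=> [a [b [ab0 ha hb]]]; exact: eigen_norm_le1 ab0 ha hb.
Qed.

Lemma spectral_radius_cayley_lt1 :
  (forall i, 0 < d 0 i) -> spectral_radius (cayley A) < 1.
Proof.
move=> d_gt0; apply: spectral_radius_lt1 => z /(cayley_eigenvector sub_unitmx).
by move=> [a [b [ab0 ha hb]]]; exact: eigen_norm_lt1 d_gt0 ab0 ha hb.
Qed.

End DiagonalTimesCoercive.
End LinearAlgebra.

(** * Finite differences of powers *)
Section FiniteDifferences.
Local Open Scope classical_set_scope.
Local Open Scope ring_scope.
Variable R : realType.
Implicit Types (f df : R -> R) (x c r : R).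

Definition fdiff f x : R := f (x + 1) - f x.

Lemma is_derive_shift f (x l : R) :
  is_derive (x + 1) 1 f l -> is_derive x 1 (fun y => f (y + 1)) l.
Proof.
move=> df; have sh : is_derive x 1 (fun y : R => y + 1) 1.
  have := is_deriveD (is_derive_id x 1) (is_derive_cst (1 : R) x 1).
  by rewrite addr0.
by have := @is_derive1_comp R f (fun y => y + 1) x _ _ df sh; rewrite mulr1.
Qed.

Lemma is_derive_iter_fdiff k f df :
  (forall x, 0 < x -> is_derive x 1 f (df x)) ->
  forall x, 0 < x -> is_derive x 1 (iter k fdiff f) (iter k fdiff df x).
Proof.
move=> hf; elim: k => [|k IH] x x0; first exact: hf.
apply: is_deriveB; last exact: IH.
by apply/is_derive_shift/IH; rewrite addr_gt0.
Qed.

Lemma is_derive_continuous f (x l : R) :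
  is_derive x 1 f l -> {for x, continuous f}.
Proof.
by move=> hf; have /derivable1_diffP/differentiable_continuous :=
  @ex_derive _ _ _ _ _ _ _ hf.
Qed.

Lemma derive_cvg_right f (x l : R) :
  is_derive x 1 f l -> f y @[y --> x^'+] --> f x.
Proof. by move=> /is_derive_continuous; exact: cvg_at_right_filter. Qed.

(** Shifted arguments are at least 1, where [f] is differentiable; at x = 0 only the unshifted term
    needs the assumed right limit. *)
Lemma iter_fdiff_cvg_right k f df x : 0 <= x ->
  (forall x, 0 < x -> is_derive x 1 f (df x)) ->
  f y @[y --> x^'+] --> f x ->
  iter k fdiff f y @[y --> x^'+] --> iter k fdiff f x.
Proof.
move=> x0 hf cf; elim: k => [//|k IH].
apply: cvgB IH; have x1 : 0 < x + 1 by rewrite ltr_wpDl.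
exact: derive_cvg_right (is_derive_shift (is_derive_iter_fdiff k hf x1)).
Qed.

(** Mean value theorem on [x, x + 1]; asking only right continuity at x admits x = 0. *)
Lemma fdiff_gt0 f df x : 0 <= x ->
  (forall y : R, 0 < y -> is_derive y 1 f (df y)) ->
  f y @[y --> x^'+] --> f x -> (forall y : R, 0 < y -> 0 < df y) ->
  0 < fdiff f x.
Proof.
move=> x0 hf cf df_gt0.
have xx1 : x < x + 1 by rewrite ltrDl.
have [||c] := @MVT R f df x (x + 1) xx1.
- by move=> y; rewrite in_itv/= => /andP[xy _]; apply/hf/(le_lt_trans x0).
- apply/continuous_within_itvP => //; split => //.
  + move=> y; rewrite in_itv/= => /andP[xy _].
    exact: is_derive_continuous (hf _ (le_lt_trans x0 xy)).
  + apply: cvg_at_left_filter.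
    exact: is_derive_continuous (hf _ (le_lt_trans x0 xx1)).
rewrite in_itv/= => /andP[xc _] fE; rewrite /fdiff fE addrC addKr mulr1.
exact/df_gt0/(le_lt_trans x0).
Qed.

Lemma is_derive_scaled_powR c r x : 0 < x ->
  is_derive x 1 (fun y => c * y `^ r) (c * r * x `^ (r - 1)).
Proof.
move=> x0; have dr := is_derive1_powR r x0.
by rewrite -mulrA; exact: (@is_deriveZ _ _ _ (fun y : R => y `^ r) c x 1 _ dr).
Qed.

(** Differencing commutes with differentiation, so the derivative of a k-th difference of c y^r is
    the k-th difference of c r y^(r-1), and the induction lowers the exponent. *)
Lemma iter_fdiff_powR_gt0 k c r x : 0 < c * \prod_(i < k) (r - i%:R) -> 0 < x ->
  0 < iter k fdiff (fun y => c * y `^ r) x.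
Proof.
elim: k c r x => [|k IH] c r x.
  by rewrite big_ord0 mulr1 => c0 x0 /=; rewrite mulr_gt0// powR_gt0.
rewrite big_ord_recl subr0 mulrA => cr x0.
have dk := is_derive_iter_fdiff k (@is_derive_scaled_powR c r).
apply: (fdiff_gt0 (ltW x0) dk (derive_cvg_right (dk x x0))) => y y0.
apply: IH y0; congr (0 < _ * _): cr; apply: eq_bigr => i _.
by rewrite lift0 -natr1; ring.
Qed.

(** Extension to x = 0: the outermost difference uses derivatives only at positive points, and y^r
    tends to 0 at 0 because r > 0. *)
Lemma iter_fdiff_powR_gt0_ge0 k c r x : 0 < r ->
  0 < c * \prod_(i < k.+1) (r - i%:R) -> 0 <= x ->
  0 < iter k.+1 fdiff (fun y => c * y `^ r) x.
Proof.
move=> r0; rewrite big_ord_recl subr0 mulrA => cr x0.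
have dk := is_derive_iter_fdiff k (@is_derive_scaled_powR c r).
apply: (fdiff_gt0 x0 dk) => [|y y0]; last first.
  apply: iter_fdiff_powR_gt0 y0; congr (0 < _ * _): cr; apply: eq_bigr => i _.
  by rewrite lift0 -natr1; ring.
have cvr := @iter_fdiff_cvg_right k _ _ x x0 (@is_derive_scaled_powR c r).
apply: cvr.
move: x0; rewrite le_eqVlt => /predU1P[<-|x0].
  rewrite powR0 ?gt_eqF// ?mulr0; rewrite -[X in _ --> X](mulr0 c).
  by apply: cvgMr; exact: powR_cvg0.
exact: derive_cvg_right (is_derive_scaled_powR c r x0).
Qed.

End FiniteDifferences.

(** * Signs and partial sums of the difference coefficients *)

Section Coefficients.
Variables (R : realType) (nu : R).
Hypothesis nu12 : 1 < nu < 2.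
Local Notation phi k := (k%:R `^ (3 - nu) : R).

Lemma gtildeSS k : gtilde nu 0 k.+2 =
  phi k.+4 - 4 * phi k.+3 + 6 * phi k.+2 - 4 * phi k.+1 + phi k.
Proof.
by rewrite /gtilde sub0n subn0 add0n addn1 /= addn1 !subSS !subn0.
Qed.

(** The sign is that of (3-nu)(2-nu)(1-nu)(-nu), which has two negative factors. *)
Lemma fourth_difference_gt0 k :
  0 < phi k.+4 - 4 * phi k.+3 + 6 * phi k.+2 - 4 * phi k.+1 + phi k.
Proof.
have /andP[nu1 nu2] := nu12.
have := @iter_fdiff_powR_gt0_ge0 R 3 1 (3 - nu) k%:R.
rewrite !big_ord_recl big_ord0 /= /fdiff !mul1r -!natr1 => /(_ _ _ _)/wrap[]//.
- by lra.
- rewrite (_ : _ * _ = (3 - nu) * (2 - nu) * (nu - 1) * nu).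
    by rewrite !mulr_gt0//; lra.
  by rewrite /bump/=; ring.
by lra.
Qed.

Lemma third_difference_lt0 k :
  phi k.+3 - 3 * phi k.+2 + 3 * phi k.+1 - phi k < 0.
Proof.
have /andP[nu1 nu2] := nu12.
have := @iter_fdiff_powR_gt0_ge0 R 2 (-1) (3 - nu) k%:R.
rewrite !big_ord_recl big_ord0 /= /fdiff !mulN1r -!natr1 => /(_ _ _ _)/wrap[]//.
- by lra.
- rewrite (_ : - _ = (3 - nu) * (2 - nu) * (nu - 1)); last by rewrite /bump/=; ring.
  by rewrite !mulr_gt0//; lra.
by lra.
Qed.

(** This central difference of |x|^(3-nu) straddles 0: the node -1 adds 1 to the central coefficient
    6. Its sign therefore does not follow from the forward differences above. *)
Lemma gtilde1 : gtilde nu 0 1 = 7 - 4 * phi 2 + phi 3.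
Proof.
rewrite /gtilde /= (_ : 5 - nu = 2 + (3 - nu)); last by ring.
rewrite powRD; last by rewrite pnatr_eq0 implybT.
by rewrite powR_mulrn//; ring.
Qed.

(* With u = nu - 1, this is the weighted arithmetic-geometric mean inequality
   9 * 3^-u + 7 >= 16 * 3^(-9u/16), followed by 3^9 <= 2^16. *)
Lemma gtilde1_ge0 : 0 <= gtilde nu 0 1.
Proof.
rewrite gtilde1; have /andP[nu1 nu2] := nu12.
have powE (b : R) : 0 < b -> b `^ (3 - nu) = b ^+ 2 * expR ((1 - nu) * ln b).
  move=> b0; rewrite (_ : 3 - nu = 2 + (1 - nu)); last by ring.
  rewrite powRD; last by rewrite (gt_eqF b0) implybT.
  by rewrite powR_mulrn ?ltW// /powR (gt_eqF b0).
rewrite !powE//.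
have ln23 : 9 * ln (3 : R) <= 16 * ln 2.
  rewrite -!ln_powR ler_ln ?posrE ?powR_gt0// !powR_mulrn// -!natrX ler_nat.
  by [].
(* [t0] is the mean of (1 - nu) ln 3 and 0 with weights 9/16 and 7/16; [e3] and [e1] are
   tangent-line bounds for the exponential at [t0]. *)
pose t0 := 9 / 16 * ((1 - nu) * ln 3) : R.
have e3 : expR t0 * (1 + ((1 - nu) * ln 3 - t0)) <= expR ((1 - nu) * ln 3).
  rewrite -[X in _ <= expR X](subrK t0) expRD mulrC ler_pM2r ?expR_gt0//.
  exact: expR_ge1Dx.
have e1 : expR t0 * (1 - t0) <= 1.
  by rewrite -ler_pdivlMl ?expR_gt0// mulr1 -expRN expR_ge1Dx.
have e2 : expR ((1 - nu) * ln 2) <= expR t0.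
  by rewrite ler_expR /t0; nra.
have -> : (2 : R) ^+ 2 = 4 by ring.
have -> : (3 : R) ^+ 2 = 9 by ring.
suff : 16 * expR t0 <= 9 * expR ((1 - nu) * ln 3) + 7 by lra.
have : 9 * (expR t0 * (1 + ((1 - nu) * ln 3 - t0))) + 7 * (expR t0 * (1 - t0))
       = 16 * expR t0 by rewrite /t0; field.
by lra.
Qed.

Lemma gtilde_ge0 k : 0 <= gtilde nu 0 k.+1.
Proof.
case: k => [|k]; first exact: gtilde1_ge0.
by rewrite gtildeSS ltW// fourth_difference_gt0.
Qed.

Lemma sum_gtilde k : \sum_(d < k.+1) gtilde nu 0 d.+1 =
  4 - phi 2 + (phi k.+3 - 3 * phi k.+2 + 3 * phi k.+1 - phi k).
Proof.
have /andP[nu1 nu2] := nu12.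
elim: k => [|k IH].
  rewrite big_ord_recl big_ord0 gtilde1 powR1 powR0; last by lra.
  by ring.
by rewrite big_ord_recr /= IH gtildeSS; ring.
Qed.

(** The right side is half the absolute value of the diagonal entry, so each side of a row has its
    own half to spend. For the empty sum the claim is 2^(3-nu) < 4. *)
Lemma sum_gtilde_lt k : \sum_(d < k) gtilde nu 0 d.+1 < 4 - phi 2.
Proof.
have /andP[nu1 nu2] := nu12.
case: k => [|k]; last by rewrite sum_gtilde gtrDl third_difference_lt0.
rewrite big_ord0 subr_gt0 (_ : 4 = 2 `^ 2%:R); last by rewrite powR_mulrn//; ring.
by rewrite /powR pnatr_eq0 /= ltr_expR ltr_pM2r ?ln_gt0//; lra.
Qed.

Lemma gtilde0 : gtilde nu 0 0 = - 2 * (4 - phi 2).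
Proof. by rewrite /gtilde /=; ring. Qed.

Lemma gtilde_dist i j : gtilde nu i j = gtilde nu 0 ((i - j) + (j - i)).
Proof. by rewrite /gtilde sub0n subn0 add0n. Qed.

Lemma gtildeC i j : gtilde nu i j = gtilde nu j i.
Proof. by rewrite gtilde_dist addnC -gtilde_dist. Qed.

End Coefficients.

(** * Diagonal dominance *)
Section DiagonalDominance.
Variable R : realType.

Lemma diag_dominant_coercive n (S : 'M[R]_n) (del : R) : 0 < del -> S^T = S ->
  (forall i, del + \sum_(j | j != i) `|S i j| <= S i i) -> coercive S.
Proof.
move=> del0 S_sym dom; exists del => // u.
(* An off-diagonal term is bounded by [t i j + t j i]; by symmetry of [S] these regroup into row
   sums. *)
pose t i j := `|S i j| * (u i 0 ^+ 2 / 2).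
have S_C i j : S j i = S i j by rewrite -{1}S_sym mxE.
have bformE : bform S u u = \sum_i \sum_j u i 0 * S i j * u j 0.
  rewrite /bform mxE exchange_big; apply: eq_bigr => j _.
  by rewrite mxE mulr_suml; apply: eq_bigr => i _; rewrite mxE.
have sum_t : \sum_i \sum_(j | j != i) (t i j + t j i) =
    \sum_i (\sum_(j | j != i) `|S i j|) * u i 0 ^+ 2.
  under eq_bigr do rewrite big_split; rewrite big_split /=.
  rewrite [X in _ + X](exchange_big_dep predT)//= -big_split /=.
  apply: eq_bigr => i _; rewrite mulr_suml.
  under [X in _ + X]eq_bigl do rewrite eq_sym.
  rewrite -big_split /=; apply: eq_bigr => j _; rewrite /t.
  by rewrite -mulrDr -splitr.
rewrite bformE mulr_sumr.
apply: (@le_trans _ _ (\sum_i (S i i * u i 0 ^+ 2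
    - (\sum_(j | j != i) `|S i j|) * u i 0 ^+ 2))).
  apply: ler_sum => i _; rewrite -mulrBl ler_wpM2r ?sqr_ge0//.
  by rewrite lerBrDr dom.
rewrite sumrB -sum_t -sumrB; apply: ler_sum => i _.
rewrite [leRHS](bigD1 i)//= -sumrN; apply: lerD.
  by rewrite expr2 mulrA (mulrC (S i i)).
apply: ler_sum => j _; rewrite /t (S_C i j) -mulrDr -mulNr.
have := ler_norm (S i j); have := ler_norm (- S i j); rewrite normrN.
move: (u i 0) (u j 0) (S i j) => x y s; move: `|s| => a sa1 sa2.
(* [h1] and [h2] add up to 2 a (x^2 + y^2) + 4 s x y >= 0. *)
have h1 : 0 <= (a - s) * (x - y) ^+ 2 by rewrite mulr_ge0 ?sqr_ge0//; lra.
have h2 : 0 <= (a + s) * (x + y) ^+ 2 by rewrite mulr_ge0 ?sqr_ge0//; lra.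
by lra.
Qed.

Lemma sum_injective_le (I : finType) (P : pred I) (h : I -> nat) N (F : nat -> R) :
    (forall k, 0 <= F k) -> {in P &, injective h} ->
    (forall i, P i -> (h i < N)%N) ->
  \sum_(i | P i) F (h i) <= \sum_(k < N) F k.
Proof.
move=> F_ge0 h_inj hN.
have -> : \sum_(i | P i) F (h i) =
    \sum_(i | P i) \sum_(k < N | h i == k) F k.
  by apply: eq_bigr => i Pi; rewrite (big_pred1 (Ordinal (hN i Pi))).
rewrite (exchange_big_dep predT)//=; apply: ler_sum => k _.
rewrite sumr_const -[leRHS]mulr1n ler_wpMn2l//.
apply/card_le1_eqP => i j /andP[Pi /eqP hi] /andP[Pj /eqP hj].
by apply: h_inj => //; rewrite hi.
Qed.

Section Lines.
Variables (nu : R) (n : nat) (E : eqType) (line : 'I_n -> E) (pos : 'I_n -> nat).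
Hypotheses (nu12 : 1 < nu < 2).
Hypothesis line_pos_inj : injective (fun i => (line i, pos i)).

(** Negated so that the diagonal is positive; [line] makes the matrix block diagonal under any
    numbering of the nodes. *)
Definition riesz_mx : 'M[R]_n :=
  \matrix_(i, j) if line i == line j then - gtilde nu (pos i) (pos j) else 0.

Lemma riesz_mx_sym : riesz_mx^T = riesz_mx.
Proof. by apply/matrixP => i j; rewrite !mxE eq_sym gtildeC. Qed.

(** On each side of a node, the other nodes of its line lie at distinct distances, so each half of
    the row is at most one partial sum of coefficients. [del] is twice the gap left by
    [sum_gtilde_lt]. *)
Lemma riesz_mx_coercive : coercive riesz_mx.
Proof.
pose N := (\max_i pos i).+1.
have posN i : (pos i < N)%N by rewrite ltnS; exact: leq_bigmax.
pose del := 2 * (4 - 2 `^ (3 - nu) - \sum_(k < N) gtilde nu 0 k.+1).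
apply: (@diag_dominant_coercive _ _ del); first last.
- move=> i; rewrite [leRHS]mxE eqxx.
  pose below j := (line i == line j) && (pos j < pos i)%N.
  pose above j := (line i == line j) && (pos i < pos j)%N.
  have -> : \sum_(j | j != i) `|riesz_mx i j| =
      \sum_(j | below j) gtilde nu 0 (pos i - pos j).-1.+1 +
      \sum_(j | above j) gtilde nu 0 (pos j - pos i).-1.+1.
    rewrite big_mkcond [X in X + _]big_mkcond [X in _ + X]big_mkcond -big_split /=.
    apply: eq_bigr => j _; rewrite mxE /below /above.
    have [->|ji] := eqVneq j i; first by rewrite ltnn andbF addr0.
    have [lij /=|_ /=] := eqVneq (line i) (line j); last by rewrite normr0 addr0.
    rewrite normrN gtilde_dist.
    have [lt_ij|lt_ji|eq_ij] := ltngtP (pos i) (pos j).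
    + have -> : ((pos i - pos j) + (pos j - pos i) = (pos j - pos i).-1.+1)%N by lia.
      by rewrite ger0_norm ?gtilde_ge0// add0r.
    + have -> : ((pos i - pos j) + (pos j - pos i) = (pos i - pos j).-1.+1)%N by lia.
      by rewrite ger0_norm ?gtilde_ge0// addr0.
    + by case/eqP: ji; apply: line_pos_inj; rewrite lij eq_ij.
  have half (P : pred 'I_n) (h : 'I_n -> nat) :
      {in P &, injective h} -> (forall j, P j -> (h j < N)%N) ->
      \sum_(j | P j) gtilde nu 0 (h j).+1 <= \sum_(k < N) gtilde nu 0 k.+1.
    apply: (@sum_injective_le _ _ _ _ (fun k => gtilde nu 0 k.+1)) => k.
    exact: gtilde_ge0.
  have hb : {in below &, injective (fun j => (pos i - pos j).-1)}.
    move=> j l /andP[/eqP lj pj] /andP[/eqP ll pl] jl; apply: line_pos_inj.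
    by rewrite -lj -ll; congr (_, _); lia.
  have ha : {in above &, injective (fun j => (pos j - pos i).-1)}.
    move=> j l /andP[/eqP lj pj] /andP[/eqP ll pl] jl; apply: line_pos_inj.
    by rewrite -lj -ll; congr (_, _); lia.
  have subN k l : ((pos k - pos l).-1 < N)%N.
    exact: leq_ltn_trans (leq_trans (leq_pred _) (leq_subr _ _)) (posN k).
  have := half _ _ hb (fun j _ => subN i j).
  have := half _ _ ha (fun j _ => subN j i).
  by rewrite gtilde_dist subnn addn0 gtilde0 /del; lra.
- exact: riesz_mx_sym.
- by rewrite mulr_gt0// subr_gt0 sum_gtilde_lt.
Qed.

End Lines.
End DiagonalDominance.

(** * Signs of the constants *)
Section GammaPositivity.
Variable R : realType.
Local Notation mu := (@lebesgue_measure R).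

Lemma powR_le_1Dsqr (t r : R) : 0 <= t -> 0 <= r <= 2 -> t `^ r <= 1 + t ^+ 2.
Proof.
move=> t0 /andP[r0 r2]; have [t1|/ltW t1] := leP t 1.
  apply: (@le_trans _ _ 1); last by rewrite lerDl sqr_ge0.
  have -> : 1 = 1 `^ r by rewrite powR1.
  by rewrite ge0_ler_powR ?nnegrE.
apply: (@le_trans _ _ (t ^+ 2)); last by rewrite lerDr.
by rewrite -powR_mulrn// ler_powR.
Qed.

(** An infinite integral would be read as 0 by [fine], so finiteness is proved too, by an
    exponential majorant. Positivity comes from [1, 2], where the integrand is at least exp(-2). *)
Lemma Gamma_gt0 (s : R) : 1 <= s <= 3 -> 0 < Gamma s.
Proof.
move=> /andP[s1 s3].
pose h t : R := t `^ (s - 1) * expR (- t).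
have h_ge0 t : 0 <= h t by rewrite mulr_ge0 ?powR_ge0 ?expR_ge0.
have mh : measurable_fun [set: R] h.
  apply: measurable_funM; first exact: measurable_powR.
  by apply: measurableT_comp => //; exact: measurable_expR.
(* t^(s-1) <= 1 + t^2 <= 16 (1 + t/4)^2 <= 16 exp(t/2), and the density of rate 1/2 carries a factor
   1/2, whence 32. *)
have h_le t : 0 <= t -> h t <= 32 * exponential_pdf 2^-1 t.
  move=> t0; rewrite exponential_pdfE// /h.
  have e4 : (1 + t / 4) ^+ 2 <= expR (t / 2).
    rewrite (_ : t / 2 = 2%:R * (t / 4)); last by field.
    rewrite expRM_natl lerXn2r ?nnegrE ?expR_ge0 ?expR_ge1Dx//; lra.
  have p : t `^ (s - 1) <= 16 * expR (t / 2).
    apply: le_trans (powR_le_1Dsqr t0 _) _; first by apply/andP; split; lra.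
    by nra.
  rewrite (_ : 32 * _ = 16 * expR (t / 2) * expR (- t)).
    by rewrite ler_wpM2r ?expR_ge0.
  rewrite -[RHS]mulrA -expRD (_ : t / 2 - t = - 2^-1 * t); last by field.
  by field.
have h_ge (t : R) : 1 <= t <= 2 -> expR (- 2) <= h t.
  move=> /andP[t1 t2]; rewrite /h -[leLHS]mul1r.
  apply: ler_pM; rewrite ?expR_ge0 ?ler_expR//; last by lra.
  by rewrite -[leLHS](powRr0 t) ler_powR//; lra.
have h_int : mu.-integrable `[0, +oo[%classic (EFin \o h).
  apply: (@le_integrable _ _ _ mu _ _ _
    (fun t => (32%:E * (exponential_pdf 2^-1 t)%:E)%E)) => //.
  - by apply/measurable_EFinP; exact: measurable_funS mh.
  - move=> t /=; rewrite in_itv/= andbT => t0.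
    rewrite ger0_norm// lee_fin ger0_norm ?h_le//.
    by rewrite mulr_ge0// exponential_pdf_ge0.
  - apply: integrableZl => //; apply: (@integrableS _ _ _ mu setT) => //.
    by apply: integrable_exponential_pdf.
rewrite /Gamma /Rintegral -/h fine_gt0//; apply/andP.
split; last exact: integrable_lty.
apply: (@lt_le_trans _ _ (\int[mu]_(t in `[1%R, 2%R]) (expR (- 2))%:E)%E).
  rewrite integral_cst//= lebesgue_measure_itv/= lte_fin ltr1n.
  by rewrite -EFinB -EFinM lte_fin mulr_gt0 ?expR_gt0//; lra.
apply: (@le_trans _ _ (\int[mu]_(t in `[1%R, 2%R]) (h t)%:E)%E).
  apply: ge0_le_integral => //.
  by apply/measurable_EFinP; exact: measurable_funS mh.
apply: ge0_subset_integral => //.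
- by apply/measurable_EFinP; exact: measurable_funS mh.
- by move=> t _; rewrite lee_fin.
- by move=> t /=; rewrite !in_itv/= andbT => /andP[t1 _]; exact: le_trans ler01 t1.
Qed.

Lemma kappa_lt0 (nu : R) : 1 < nu < 2 -> kappa nu < 0.
Proof.
move=> /andP[nu1 nu2]; have pi0 := pi_gt0 R.
rewrite /kappa invr_lt0 pmulr_rlt0//.
(* A quarter-turn shift turns the cosine into minus the sine of an angle in ]0, pi/2[. *)
rewrite (_ : nu * pi / 2 = (nu - 1) * pi / 2 + pi / 2); last by field.
rewrite cosDpihalf oppr_lt0; apply: sin_gt0_pi; nra.
Qed.

End GammaPositivity.

(** * Mesh points, weights, and assembly of the three directions *)

Lemma step_gt0 (R : realType) (a b : R) N : a < b -> (0 < N)%N -> 0 < step a b N.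
Proof. by move=> ab N0; rewrite /step divr_gt0 ?subr_gt0// ltr0n. Qed.

Lemma node_interior (R : realType) (a b : R) N (i : 'I_N.-1) : a < b ->
  a < node a (step a b N) i.+1 < b.
Proof.
move=> ab; case: N i => [[]//|N] i /=; rewrite /node.
have h0 : 0 < step a b N.+1 by exact: step_gt0.
rewrite ltrDl mulr_gt0//= -ltrBrDl.
have -> : b - a = N.+1%:R * step a b N.+1.
  by rewrite /step mulrC divfK// pnatr_eq0.
by rewrite ltr_pM2r// ltr_nat ltnS.
Qed.

Lemma tmid_interior (R : realType) (T : R) N k : 0 < T -> (k < N)%N ->
  0 < tmid (step 0 T N) k <= T.
Proof.
move=> T0 kN; have N0 : (0 < N)%N by exact: leq_ltn_trans kN.
have h0 : 0 < step 0 T N by exact: step_gt0.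
have TE : T = N%:R * step 0 T N by rewrite /step subr0 mulrC divfK// pnatr_eq0 -lt0n.
have k0 : (0 : R) <= k%:R by [].
have kN' : k.+1%:R <= N%:R :> R by rewrite ler_nat.
rewrite /tmid; apply/andP; split; first by rewrite -natr1; nra.
by rewrite [leRHS]TE -natr1; move: kN'; rewrite -natr1; nra.
Qed.

(** The explicit minus sign compensates the negative [kappa nu]. *)
Lemma weight_ge0 (R : realType) (nu h dt c : R) : 1 < nu < 2 -> 0 < h -> 0 < dt ->
  let w := - dt * kappa nu * c / (2 * Gamma (4 - nu) * h `^ nu) in
  (0 <= c -> 0 <= w) /\ (0 < c -> 0 < w).
Proof.
move=> nu12 h0 dt0 w; have k0 := kappa_lt0 nu12; have /andP[nu1 nu2] := nu12.
have G0 : 0 < Gamma (4 - nu) by apply: Gamma_gt0; apply/andP; split; lra.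
have D0 : 0 < 2 * Gamma (4 - nu) * h `^ nu by rewrite !mulr_gt0// powR_gt0.
have m0 : 0 < - dt * kappa nu by rewrite mulNr oppr_gt0 pmulr_rlt0.
split=> c0; first by rewrite /w divr_ge0 ?(ltW D0)// mulr_ge0// ltW.
by rewrite /w divr_gt0// mulr_gt0.
Qed.

(* [line] and [pos] split an interior node into the grid line carrying the
   difference operator and the position on that line; the three directions differ
   only in this choice. *)
Lemma direction_stability (R : realType) (Nx Ny Nz : nat) (E : eqType)
    (line : Defs.interior Nx Ny Nz -> E) (pos : Defs.interior Nx Ny Nz -> nat)
    (nu h dt : R) (c : Defs.interior Nx Ny Nz -> R) :
  1 < nu < 2 -> 0 < h -> 0 < dt -> (forall p, 0 <= c p) ->
  injective (fun p => (line p, pos p)) ->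
  let A := gmat (fun p q => if line p == line q
    then - dt * kappa nu * c p / (2 * Gamma (4 - nu) * h `^ nu)
         * gtilde nu (pos p) (pos q)
    else 0) in
  [/\ 1%:M - A \in unitmx, power_bounded (cayley A),
      spectral_radius (cayley A) <= 1 &
      (forall p, 0 < c p) -> spectral_radius (cayley A) < 1].
Proof.
move=> nu12 h0 dt0 c0 inj A.
pose w p := - dt * kappa nu * c p / (2 * Gamma (4 - nu) * h `^ nu).
pose d : 'rV[R]_#|Defs.interior Nx Ny Nz| := \row_i w (enum_val i).
have d0 i : 0 <= d 0 i by rewrite mxE; apply: (weight_ge0 _ nu12 h0 dt0).1.
pose p_ (i : 'I_#|Defs.interior Nx Ny Nz|) : Defs.interior Nx Ny Nz := enum_val i.
pose S := riesz_mx nu (line \o p_) (pos \o p_).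
(* The outer minus sign undoes the one built into [riesz_mx]. *)
have -> : A = - (diag_mx d *m S).
  apply/matrixP => i j; rewrite mul_diag_mx !mxE /=.
  by case: ifP => _; rewrite ?mulr0 ?oppr0// mulrN opprK.
have S_sym : S^T = S by exact: riesz_mx_sym.
have S_coer : coercive S.
  by apply: riesz_mx_coercive => // i j /= /inj /enum_val_inj.
split; [exact: sub_unitmx|exact: cayley_power_bounded|
        exact: spectral_radius_cayley_le1|].
move=> cpos; apply: spectral_radius_cayley_lt1 => // i.
by rewrite mxE; apply: (weight_ge0 _ nu12 h0 dt0).2.
Qed.

Theorem theorem3p4 (R : realType) (alpha beta gamma : R)
  (halpha : 1 < alpha < 2) (hbeta : 1 < beta < 2) (hgamma : 1 < gamma < 2)
  (xL xR yL yR zL zR T : R)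
  (hx : xL < xR) (hy : yL < yR) (hz : zL < zR) (hT : 0 < T)
  (c d e f : R -> R -> R -> R -> R)
  (hcde : forall x y z t : R, xL < x < xR -> yL < y < yR -> zL < z < zR ->
     0 < t <= T -> [/\ 0 <= c x y z t, 0 <= d x y z t & 0 <= e x y z t])
  (Nx Ny Nz Nt : nat)
  (hNx : (0 < Nx)%N) (hNy : (0 < Ny)%N) (hNz : (0 < Nz)%N) (hNt : (0 < Nt)%N)
  (k : nat) (hk : (k < Nt)%N) :
  let dx := step xL xR Nx in
  let dy := step yL yR Ny in
  let dz := step zL zR Nz in
  let dt := step 0 T Nt in
  let at_nodes := @sample R Nx Ny Nz xL dx yL dy zL dz (tmid dt k) in
  let A_x := Ax alpha dx dt (at_nodes c) in
  let A_y := Ay beta dy dt (at_nodes d) in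
  let A_z := Az gamma dz dt (at_nodes e) in
  pairwise_commute A_x A_y A_z ->
  [/\ dad_amplification A_x A_y A_z dt (gvec (at_nodes f)),
      power_bounded (cayley A_x *m cayley A_y *m cayley A_z),
      [/\ spectral_radius (cayley A_x) <= 1,
          spectral_radius (cayley A_y) <= 1 &
          spectral_radius (cayley A_z) <= 1] &
      [/\ (forall p, 0 < at_nodes c p) -> spectral_radius (cayley A_x) < 1,
          (forall p, 0 < at_nodes d p) -> spectral_radius (cayley A_y) < 1 &
          (forall p, 0 < at_nodes e p) -> spectral_radius (cayley A_z) < 1]].
Proof.
move=> dx dy dz dt at_nodes A_x A_y A_z comm.
have dt0 : 0 < dt by exact: step_gt0.
(* The signs are assumed on the open box and ]0, T] only; interior nodes and the midpoint time lie
   there. *)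
have coef_ge0 p : [/\ 0 <= at_nodes c p, 0 <= at_nodes d p & 0 <= at_nodes e p].
  apply: hcde; [exact: node_interior..|exact: tmid_interior].
have [c0 d0 e0] : [/\ forall p, 0 <= at_nodes c p, forall p, 0 <= at_nodes d p &
    forall p, 0 <= at_nodes e p] by split=> p; case: (coef_ge0 p).
have [uX pX leX ltX] : [/\ 1%:M - A_x \in unitmx, power_bounded (cayley A_x),
    spectral_radius (cayley A_x) <= 1 &
    (forall p, 0 < at_nodes c p) -> spectral_radius (cayley A_x) < 1].
  apply: (direction_stability (line := fun p => (p.1.2, p.2))
    (pos := fun p => p.1.1.+1) halpha (step_gt0 hx hNx) dt0 c0).
  by move=> [[i j] l] [[i' j'] l'] /= [-> -> /val_inj->].
have [uY pY leY ltY] : [/\ 1%:M - A_y \in unitmx, power_bounded (cayley A_y),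
    spectral_radius (cayley A_y) <= 1 &
    (forall p, 0 < at_nodes d p) -> spectral_radius (cayley A_y) < 1].
  apply: (direction_stability (line := fun p => (p.1.1, p.2))
    (pos := fun p => p.1.2.+1) hbeta (step_gt0 hy hNy) dt0 d0).
  by move=> [[i j] l] [[i' j'] l'] /= [-> -> /val_inj->].
have [uZ pZ leZ ltZ] : [/\ 1%:M - A_z \in unitmx, power_bounded (cayley A_z),
    spectral_radius (cayley A_z) <= 1 &
    (forall p, 0 < at_nodes e p) -> spectral_radius (cayley A_z) < 1].
  apply: (direction_stability (line := fun p => (p.1.1, p.1.2))
    (pos := fun p => p.2.+1) hgamma (step_gt0 hz hNz) dt0 e0).
  by move=> [[i j] l] [[i' j'] l'] /= [-> -> /val_inj->].
have [cXY cXZ cYZ] := comm.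
split; [exact: dad_amplificationP| |by split|by split].
have pXY : power_bounded (cayley A_x *m cayley A_y).
  by apply: power_boundedM pX pY; exact: cayley_comm.
(* It remains to commute the third transform past the product of the first two. *)
apply: power_boundedM pXY pZ.
move: (cayley_comm cXZ) (cayley_comm cYZ).
move: (cayley A_x) (cayley A_y) (cayley A_z) => X Y Z hXZ hYZ.
by rewrite -mulmxA hYZ !mulmxA hXZ.
Qed.
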